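(* Let $X=W^{\alpha,\psi}_2(\Omega)$, and let $\{e_k\}_{k=1}^\infty$ be a complete orthonormal basis of $X$. For $N\in\mathbb{N}$ and $u\in X$ define $u_N=\sum_{k=1}^N\langle u,e_k\rangle e_k$. Let $y\in\mathbb{R}^m$ and let $G:X\to\mathbb{R}^m$ satisfy: (A1) for every $\varepsilon>0$ there exists $M=M(\varepsilon)\in\mathbb{R}$ such that $\|G(u)\|_\Sigma\leqslant\exp(\varepsilon\|u\|_X^2+M)$ for all $u\in X$; (A2) for every $r>0$ there exists $K=K(r)>0$ such that $\|G(u_1)-G(u_2)\|_\Sigma\leqslant K\|u_1-u_2\|_X$ for all $u_1,u_2\in X$ with $\max\{\|u_1\|_X,\|u_2\|_X\}<r$. Put $\Phi(u)=\frac12\|G(u)-y\|_\Sigma^2$, let $\lambda>0$ and $R(u)=\lambda\int_a^b|D^{\alpha,\psi}_{[a,b]}u|\,dx$, and let $\mu^y$ and $\mu^y_N$ be the probability measures on $X$ given by $$\frac{d\mu^y}{d\mu_0}(u)\propto\exp(-\Phi(u)-R(u)),\qquad \frac{d\mu^y_N}{d\mu_0}(u)\propto\exp(-\Phi(u_N)-R(u_N)).$$ Then $$d_{Hell}(\mu^y,\mu^y_N)\to 0\quad\text{as }N\to\infty.$$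
   Context: $\Omega=[a,b]$ is a finite interval, $\alpha>0$ is real, $n=[\alpha]+1$, and $\psi\in C^n(\Omega)$ is increasing with $\psi'(x)\neq 0$ for all $x\in\Omega$. Functions are real-valued. Write $D_\psi=\frac{1}{\psi'(x)}\frac{d}{dx}$. For $\beta>0$ the fractional integrals with respect to $\psi$ are $$I^{\beta,\psi}_{[a,x]}f(x)=\frac{1}{\Gamma(\beta)}\int_a^x\frac{\psi'(t)f(t)\,dt}{(\psi(x)-\psi(t))^{1-\beta}},\qquad I^{\beta,\psi}_{[x,b]}f(x)=\frac{1}{\Gamma(\beta)}\int_x^b\frac{\psi'(t)f(t)\,dt}{(\psi(t)-\psi(x))^{1-\beta}}.$$ The left and right Riemann-Liouville derivatives with respect to $\psi$ are $D^{\alpha,\psi}_{[a,x]}f=D_\psi^n I^{n-\alpha,\psi}_{[a,x]}f$ and $D^{\alpha,\psi}_{[x,b]}f=(-D_\psi)^n I^{n-\alpha,\psi}_{[x,b]}f$, and the Riesz (Riemann-Liouville) fractional derivative is $$D^{\alpha,\psi}_{[a,b]}f=\tfrac12\left(D^{\alpha,\psi}_{[a,x]}f+(-1)^nD^{\alpha,\psi}_{[x,b]}f\right).$$ Test functions: $\mathcal{C}^n_0(\Omega,\mathbb{R})$ is the set of $g\in C^n(\Omega)$ with $D_\psi^i g=0$ at $a$ and at $b$ for all $i=0,1,\dots,n$. For $u\in L^2(\Omega)$, $D^{\alpha,\psi}_{[a,b]}u$ is understood in the weak sense: it is the function $v\in L^2(\Omega)$ (if it exists) such that $$\int_a^b\psi'\,u\,D^{\alpha,\psi}_{[a,b]}g\,dx=(-1)^n\int_a^b\psi'\,v\,g\,dx\quad\text{for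 all }g\in\mathcal{C}^n_0(\Omega,\mathbb{R}).$$ $X=W^{\alpha,\psi}_2(\Omega)$ is the set of $u\in L^2(\Omega)$ (modulo a.e. equality) for which $D^{\alpha,\psi}_{[a,b]}u\in L^2(\Omega)$ exists; it is a separable Hilbert space with inner product $$\langle u,v\rangle=\int_a^b uv\,dx+\int_a^b(D^{\alpha,\psi}_{[a,b]}u)(D^{\alpha,\psi}_{[a,b]}v)\,dx .$$ $\mu_0=\mathcal{N}(0,\mathcal{C}_0)$ is a Gaussian measure on $X$ with mean zero and symmetric positive trace-class covariance operator $\mathcal{C}_0$. $\Sigma$ is the (symmetric positive definite) $m\times m$ covariance matrix of the observation noise, and $\|z\|_\Sigma=\|\Sigma^{-1/2}z\|_2$ for $z\in\mathbb{R}^m$. The symbol $\propto$ means equality up to a normalization constant making the measure a probability measure. The Hellinger metric between measures $\mu,\mu'$ both absolutely continuous with respect to a measure $\nu$ on $X$ is $$d_{Hell}(\mu,\mu')=\sqrt{\frac12\int_X\left(\sqrt{\frac{d\mu}{d\nu}}-\sqrt{\frac{d\mu'}{d\nu}}\right)^2d\nu}.$$ *)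

(* Defs.v *)
From HB Require Import structures.
From mathcomp Require Import all_boot all_order all_algebra generic_quotient.
From mathcomp Require Import all_classical all_reals all_analysis.
From mathcomp Require Import measurable_realfun ess_sup_inf ring.
Set Implicit Arguments.
Unset Strict Implicit.
Unset Printing Implicit Defensive.
Import Order.TTheory GRing.Theory Num.Theory.
Import numFieldNormedType.Exports.
Local Open Scope classical_set_scope.
Local Open Scope ring_scope.
Local Open Scope quotient_scope.

Section AeEqMfunLmodule.
Context d (T : measurableType d) (R : realType) (mu : {measure set T -> \bar R}).
Local Notation M := {mfun_ mu, T >-> measurableTypeR R}.

Lemma ae_class_measurable (u : M) : measurable_fun [set: T] (u : T -> R).
Proof. exact: (@measurable_funPT _ _ _ _ (repr u)). Qed.

Definition ae_class (f : T -> R) (mf : measurable_fun [set: T] f) : M :=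
  \pi_M (HB.pack_for {mfun T >-> measurableTypeR R} f
    (isMeasurableFun.Build _ _ T (measurableTypeR R) f mf)).

Lemma ae_classE f mf : (@ae_class f mf : T -> R) = f %[ae mu].
Proof.
have : ae_class mf == \pi_M (repr (ae_class mf)) by rewrite reprK.
by rewrite eq_sym eqmodE => /asboolP.
Qed.

Lemma ae_class_eq (u v : M) : (u : T -> R) = v %[ae mu] -> u = v.
Proof. by move=> uv; rewrite -[u]reprK -[v]reprK; apply/eqP; rewrite eqmodE; apply/asboolP. Qed.

Lemma ae_opp_measurable (u : M) : measurable_fun [set: T] (fun t => - (u t : R)).
Proof. exact: measurableT_comp (ae_class_measurable u). Qed.

Definition ae_zero : M := ae_class (measurable_cst (0 : R)).
Definition ae_opp (u : M) : M :=
  ae_class (ae_opp_measurable u).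
Definition ae_add (u v : M) : M :=
  ae_class (measurable_funD (ae_class_measurable u) (ae_class_measurable v)).
Definition ae_scale (c : R) (u : M) : M :=
  ae_class (measurable_funM (measurable_cst c) (ae_class_measurable u)).

Let addE u v : {ae mu, forall t, ae_add u v t = (u t : R) + v t :> R}.
Proof. by have := ae_classE (measurable_funD (ae_class_measurable u) (ae_class_measurable v)); apply: filterS => t /(_ I). Qed.
Let oppE u : {ae mu, forall t, ae_opp u t = - (u t : R) :> R}.
Proof. by have := ae_classE (ae_opp_measurable u); apply: filterS => t /(_ I). Qed.
Let zeroE : {ae mu, forall t, ae_zero t = 0 :> R}.
Proof. by have := ae_classE (measurable_cst (0 : R)); apply: filterS => t /(_ I). Qed.
Let scaleE c u : {ae mu, forall t, ae_scale c u t = c * (u t : R) :> R}.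
Proof. by have := ae_classE (measurable_funM (measurable_cst c) (ae_class_measurable u)); apply: filterS => t /(_ I). Qed.
Let aeqP (u v : M) : {ae mu, forall t, (u t : R) = v t} -> u = v.
Proof. by move=> uv; apply: ae_class_eq; apply: filterS uv. Qed.

Let addA : associative ae_add.
Proof.
move=> u v w; apply: aeqP; near=> t.
transitivity ((u t : R) + v t + w t).
  transitivity ((u t : R) + ae_add v w t); first by near: t.
  by rewrite -addrA; congr (_ + _); near: t.
transitivity ((ae_add u v t : R) + w t); last by apply/esym; near: t.
by congr (_ + _); apply/esym; near: t.
Unshelve. all: by end_near. Qed.

Let addC : commutative ae_add.
Proof.
move=> u v; apply: aeqP; near=> t.
transitivity ((u t : R) + v t); first by near: t.
by rewrite addrC; apply/esym; near: t.
Unshelve. all: by end_near. Qed.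

Let add0 : left_id ae_zero ae_add.
Proof.
move=> u; apply: aeqP; near=> t.
transitivity ((ae_zero t : R) + u t); first by near: t.
by rewrite -[RHS]add0r; congr (_ + _); near: t.
Unshelve. all: by end_near. Qed.

Let addN : left_inverse ae_zero ae_opp ae_add.
Proof.
move=> u; apply: aeqP; near=> t.
transitivity ((ae_opp u t : R) + u t); first by near: t.
transitivity (- (u t : R) + u t); first by congr (_ + _); near: t.
by rewrite addNr; apply/esym; near: t.
Unshelve. all: by end_near. Qed.

HB.instance Definition _ := GRing.isZmodule.Build M addA addC add0 addN.

Let scaleA a b (u : M) : ae_scale a (ae_scale b u) = ae_scale (a * b) u.
Proof.
apply: aeqP; near=> t.
transitivity (a * (ae_scale b u t : R)); first by near: t.
transitivity (a * b * (u t : R)); last by apply/esym; near: t.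
by rewrite -mulrA; congr (_ * _); near: t.
Unshelve. all: by end_near. Qed.

Let scale1 : left_id 1 ae_scale.
Proof.
move=> u; apply: aeqP; near=> t.
by rewrite -[RHS]mul1r; near: t.
Unshelve. all: by end_near. Qed.

Let scaleDr : right_distributive ae_scale +%R.
Proof.
move=> a u v; apply: aeqP; near=> t.
transitivity (a * (ae_add u v t : R)); first by near: t.
transitivity (a * ((u t : R) + v t)); first by congr (_ * _); near: t.
transitivity ((ae_scale a u t : R) + ae_scale a v t); last by apply/esym; near: t.
by rewrite mulrDr; congr (_ + _); apply/esym; near: t.
Unshelve. all: by end_near. Qed.

Let scaleDl u : {morph ae_scale^~ u : a b / a + b}.
Proof.
move=> a b; apply: aeqP; near=> t.
transitivity ((a + b) * (u t : R)); first by near: t.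
transitivity ((ae_scale a u t : R) + ae_scale b u t); last by apply/esym; near: t.
by rewrite mulrDl; congr (_ + _); apply/esym; near: t.
Unshelve. all: by end_near. Qed.

HB.instance Definition _ := GRing.Zmodule_isLmodule.Build R M
  scaleA scale1 scaleDr scaleDl.

Lemma ae_eq_scaleD (c : R) (u v : M) :
  {ae mu, forall t, (c *: u + v : M) t = c * (u t : R) + v t :> R}.
Proof.
near=> t.
transitivity ((ae_scale c u t : R) + v t); first by near: t.
by congr (_ + _); near: t.
Unshelve. all: by end_near. Qed.

End AeEqMfunLmodule.

Section LspaceLmodule.
Context d (T : measurableType d) (R : realType) (mu : {measure set T -> \bar R}).
Variables (p : \bar R) (p1 : (1 <= p)%E).
Local Notation M := {mfun_ mu, T >-> measurableTypeR R}.

Lemma finite_norm_ae (f g : T -> R) : measurable_fun [set: T] f ->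
  measurable_fun [set: T] g -> {ae mu, forall t, f t = g t} ->
  finite_norm mu p f -> finite_norm mu p g.
Proof.
move=> mf mg fg; rewrite /finite_norm.
have fgp : ('N[mu]_p[EFin \o f] = 'N[mu]_p[EFin \o g])%E; last by rewrite fgp.
rewrite unlock /Lnorm; case: p p1 => //[r r1|_].
  congr poweR; apply: ae_eq_integral => //.
  - apply/measurable_EFinP; apply: (measurableT_comp (measurable_powR r)).
    exact: measurableT_comp.
  - apply/measurable_EFinP; apply: (measurableT_comp (measurable_powR r)).
    exact: measurableT_comp.
  - by apply: filterS fg => t /= ->.
by case: ifPn => // _; apply: eq_ess_sup; apply: filterS fg => t /= ->.
Qed.

Definition Lspace_pred : {pred M} := mem [set u : M | finite_norm mu p u].

Section Sub.
Context (u : M) (uP : u \in Lspace_pred).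
#[local] HB.instance Definition _ := @isFinLebesgue.Build d T R mu p p1 u (set_mem uP).
Definition Lspace_Sub := [the LspaceType mu p1 of u].
End Sub.

Lemma Lspace_rect (K : LspaceType mu p1 -> Type) :
  (forall u (Pu : u \in Lspace_pred), K (Lspace_Sub Pu)) -> forall u, K u.
Proof.
move=> Ksub [u [[Pu]]].
have Pu' : u \in Lspace_pred by rewrite inE.
have -> : Pu = set_mem Pu' by exact: Prop_irrelevance.
exact: Ksub.
Qed.

Lemma Lspace_valP u (Pu : u \in Lspace_pred) : Lspace_Sub Pu = u :> M.
Proof. by []. Qed.

HB.instance Definition _ :=
  isSub.Build _ _ (LspaceType mu p1) Lspace_rect Lspace_valP.

HB.instance Definition _ := [Choice of LspaceType mu p1 by <:].

Lemma Lspace_Lfun (u : M) : u \in Lspace_pred -> (u : T -> R) \in Lfun mu p.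
Proof.
by rewrite inE => uP; rewrite !inE; apply/andP; split; rewrite inE//; exact: ae_class_measurable.
Qed.

Lemma Lspace_submod_closed : submod_closed Lspace_pred.
Proof.
split=> [|c u v uP vP]; rewrite inE/=.
  have fn0 := @finite_norm_cst0 d T R mu p p1.
  apply: (finite_norm_ae (measurable_cst _) (ae_class_measurable 0) _ fn0).
  have := @ae_classE _ _ _ mu _ (measurable_cst (0 : R)).
  by apply: filterS => t /(_ I) /= ->.
have : c *: (aqEqMfun_to_fun u : T -> R) + (aqEqMfun_to_fun v : T -> R) \in Lfun mu p.
  have := (Lfun_submod_closed mu p1).2.
  by move=> /(_ c _ _ (Lspace_Lfun uP) (Lspace_Lfun vP)).
move=> /andP[]; rewrite !inE => mf; apply: finite_norm_ae => //.
  exact: ae_class_measurable.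
by have := ae_eq_scaleD c u v; apply: filterS => t ->.
Qed.

HB.instance Definition _ := GRing.isSubmodClosed.Build _ _ Lspace_pred
  Lspace_submod_closed.
HB.instance Definition _ := [SubChoice_isSubLmodule of LspaceType mu p1 by <:].
End LspaceLmodule.

Section FractionalSobolev.
Context (R : realType).
Variables (a b : R) (psi : R -> R).
Local Notation leb := (@lebesgue_measure R).

(* Derivative relative to [a, b]: one-sided at a and at b, so that only the
   values of f on [a, b] matter. *)
Definition diff_quot (f : R -> R) (x y : R) : R := (f y - f x) / (y - x).
Definition deriv_on (f : R -> R) (x : R) : R :=
  lim (diff_quot f x @ within `[a, b] x^').
Definition derivable_on (f : R -> R) : Prop :=
  forall x, x \in `[a, b]%classic -> cvg (diff_quot f x @ within `[a, b] x^').

Fixpoint Cn (n : nat) (f : R -> R) : Prop :=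
  if n is k.+1 then derivable_on f /\ Cn k (deriv_on f)
  else {within `[a, b], continuous f}.

Definition Dpsi (f : R -> R) (x : R) : R := deriv_on f x / deriv_on psi x.

Definition gamma_fun (z : R) : R :=
  \int[leb]_(t in `]0, +oo[) (t `^ (z - 1) * expR (- t)).

Definition frac_int_left (beta : R) (f : R -> R) (x : R) : R :=
  (gamma_fun beta)^-1 * \int[leb]_(t in `[a, x])
    (deriv_on psi t * f t / (psi x - psi t) `^ (1 - beta)).
Definition frac_int_right (beta : R) (f : R -> R) (x : R) : R :=
  (gamma_fun beta)^-1 * \int[leb]_(t in `[x, b])
    (deriv_on psi t * f t / (psi t - psi x) `^ (1 - beta)).

Definition frac_order (alpha : R) : nat := (Num.truncn alpha).+1.

Definition RL_left (alpha : R) (f : R -> R) : R -> R :=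
  let n := frac_order alpha in
  iter n Dpsi (frac_int_left (n%:R - alpha) f).
Definition RL_right (alpha : R) (f : R -> R) : R -> R :=
  let n := frac_order alpha in
  iter n (fun h x => - Dpsi h x) (frac_int_right (n%:R - alpha) f).
Definition riesz (alpha : R) (f : R -> R) (x : R) : R :=
  2^-1 * (RL_left alpha f x + (-1) ^+ frac_order alpha * RL_right alpha f x).

Definition test_fun (n : nat) (g : R -> R) : Prop :=
  Cn n g /\
  forall i, (i <= n)%N -> iter i Dpsi g a = 0 /\ iter i Dpsi g b = 0.

(* Lebesgue integral over [a, b] of a real function: lebesgue_measure is a
   measure on the Borel sets, so f is only asked to agree almost everywhere
   with a Borel integrable function. In particular the integral exists. *)
Definition has_integral (f : R -> R) (l : R) : Prop :=
  exists h : R -> R, [/\ leb.-integrable `[a, b] (EFin \o h),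
    {ae leb, forall x, x \in `[a, b]%classic -> f x = h x} &
    \int[leb]_(x in `[a, b]) h x = l].

Definition is_weak_riesz (alpha : R) (u v : R -> R) : Prop :=
  forall g, test_fun (frac_order alpha) g ->
  exists lu lv : R,
    [/\ has_integral (fun x => deriv_on psi x * u x * riesz alpha g x) lu,
        has_integral (fun x => deriv_on psi x * v x * g x) lv &
        lu = (-1) ^+ frac_order alpha * lv].

Definition lebesgue_on : {measure set (measurableTypeR R) -> \bar R} :=
  mrestr leb (measurable_itv `[a, b]).

Definition L2 := LspaceType2 lebesgue_on.
HB.instance Definition _ := GRing.Lmodule.on L2.
Definition L2_fun (u : L2) : R -> R := aqEqMfun_to_fun (\val u).
Coercion L2_fun : L2 >-> Funclass.

Lemma ae_lebesgue_on (P : R -> Prop) : {ae lebesgue_on, forall x, P x} ->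
  {ae leb, forall x, x \in `[a, b]%classic -> P x}.
Proof.
move=> [N [mN N0 PN]]; exists (N `&` `[a, b]); split => //.
  exact: measurableI.
move=> x /= /not_implyP[xab nP]; split; first exact: PN.
by rewrite inE in xab.
Qed.

Lemma L2_scaleD (c : R) (u v : L2) :
  {ae leb, forall x, x \in `[a, b]%classic -> L2_fun (c *: u + v) x = c * u x + v x}.
Proof. exact: ae_lebesgue_on (ae_eq_scaleD c (\val u) (\val v)). Qed.

Lemma L2_0 : {ae leb, forall x, x \in `[a, b]%classic -> L2_fun 0 x = 0}.
Proof.
apply: ae_lebesgue_on.
have := @ae_classE _ _ _ lebesgue_on _ (measurable_cst (0 : R)).
by apply: filterS => t /(_ I).
Qed.

Lemma has_integral_linear (c : R) (f g h : R -> R) (lf lg : R) :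
  {ae leb, forall x, x \in `[a, b]%classic -> h x = c * f x + g x} ->
  has_integral f lf -> has_integral g lg -> has_integral h (c * lf + lg).
Proof.
move=> hE [f' [f'i ff' <-]] [g' [g'i gg' <-]].
have mab : measurable (`[a, b]%classic : set (measurableTypeR R)) by [].
have FF := @ae_filter_ringOfSetsType _ _ R leb.
have cf'i : leb.-integrable `[a, b] (EFin \o (fun x => c * f' x)).
  exact: (integrableZl mab c f'i).
exists (fun x => c * f' x + g' x); split.
- exact: (integrableD mab cf'i g'i).
- by apply: (@filterS3 _ _ FF _ _ _ _ _ hE ff' gg') => x hx fx gx xab; rewrite hx// fx// gx.
- by rewrite RintegralD// RintegralZl.
Qed.

Lemma has_integral0 (f : R -> R) :
  {ae leb, forall x, x \in `[a, b]%classic -> f x = 0} -> has_integral f 0.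
Proof.
move=> f0; exists (cst 0); split => //.
  exact: integrable0.
by rewrite Rintegral_cst// mul0r.
Qed.

Variable alpha : R.

Definition weakly_riesz : {pred L2} :=
  mem [set u : L2 | exists v : L2, is_weak_riesz alpha u v].

Lemma weakly_riesz_submod_closed : submod_closed weakly_riesz.
Proof.
have FF := @ae_filter_ringOfSetsType _ _ R leb.
split=> [|c u1 u2]; rewrite !inE /=.
  exists 0 => g _; exists 0, 0.
  by split; rewrite ?mulr0//; apply: has_integral0; apply: (@filterS _ _ FF _ _ _ L2_0) => x /[apply] ->;
    rewrite ?(mulr0, mul0r).
move=> [v1 uv1] [v2 uv2]; exists (c *: v1 + v2) => g gt.
have [lu1 [lv1 [iu1 iv1 l1]]] := uv1 _ gt.
have [lu2 [lv2 [iu2 iv2 l2]]] := uv2 _ gt.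
exists (c * lu1 + lu2), (c * lv1 + lv2); split.
- apply: has_integral_linear iu1 iu2.
  by apply: (@filterS _ _ FF _ _ _ (L2_scaleD c u1 u2)) => x /[apply] /= ->; ring.
- apply: has_integral_linear iv1 iv2.
  by apply: (@filterS _ _ FF _ _ _ (L2_scaleD c v1 v2)) => x /[apply] /= ->; ring.
- by rewrite l1 l2; ring.
Qed.

HB.instance Definition _ := GRing.isSubmodClosed.Build _ _ weakly_riesz
  weakly_riesz_submod_closed.

Record sobolev := Sobolev { sobolev_val :> L2; _ : sobolev_val \in weakly_riesz }.
HB.instance Definition _ := [isSub for sobolev_val].
HB.instance Definition _ := [Choice of sobolev by <:].
HB.instance Definition _ := [SubChoice_isSubLmodule of sobolev by <:].
HB.instance Definition _ := isPointed.Build sobolev 0.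

Implicit Types u v h : sobolev.

(* The weak derivative of u, unique when psi' does not vanish; the default 0 is
   not used since it exists for every u : sobolev. *)
Definition weak_riesz u : L2 := xget 0 [set v : L2 | is_weak_riesz alpha u v].

Definition sob_ip u v : R :=
  \int[leb]_(x in `[a, b]) (u x * v x) +
  \int[leb]_(x in `[a, b]) (weak_riesz u x * weak_riesz v x).

Definition sob_norm u : R := Num.sqrt (sob_ip u u).

Definition sob_open : set (set sobolev) :=
  [set U | forall u, U u ->
    exists2 r : R, 0 < r & forall v, sob_norm (v - u) < r -> U v].

Definition sob_borel : measurableType _ := g_sigma_algebraType sob_open.

Definition orthonormal_seq (e : nat -> sobolev) : Prop :=
  forall i j, sob_ip (e i) (e j) = (i == j)%:R.

Definition complete_seq (e : nat -> sobolev) : Prop :=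
  forall u (eps : R), 0 < eps -> exists (N : nat) (c : nat -> R),
    sob_norm (u - \sum_(k < N) c k *: e k) < eps.

Definition onb (e : nat -> sobolev) : Prop := orthonormal_seq e /\ complete_seq e.

Definition onb_proj (e : nat -> sobolev) (N : nat) u : sobolev :=
  \sum_(k < N) sob_ip u (e k) *: e k.

Definition bounded_op (C : sobolev -> sobolev) : Prop :=
  exists M : R, forall u, sob_norm (C u) <= M * sob_norm u.

Definition symmetric_op (C : sobolev -> sobolev) : Prop :=
  forall u v, sob_ip (C u) v = sob_ip u (C v).

Definition positive_op (C : sobolev -> sobolev) : Prop :=
  forall u, 0 <= sob_ip (C u) u.

(* Trace class for a positive operator, where |C| = C: the nonnegative terms
   <C e_k, e_k> have a finite sum. *)
Definition trace_class (C : sobolev -> sobolev) : Prop :=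
  forall e : nat -> sobolev, onb e -> cvgn (series (fun k => sob_ip (C (e k)) (e k))).

(* normal_prob takes the standard deviation and is not the point mass when
   that is 0; a Gaussian law may be degenerate. *)
Definition normal_law (c s : R) (A : set (measurableTypeR R)) : \bar R :=
  if s == 0 then \d_c A else normal_prob c s A.

Definition gaussian_measure (mu : probability sob_borel R) : Prop :=
  forall h, exists c s : R, 0 <= s /\
    forall A : set (measurableTypeR R), measurable A ->
      mu [set u | A (sob_ip u h)] = normal_law c s A.

Definition mean_is (mu : probability sob_borel R) (c : sobolev) : Prop :=
  forall h, (\int[mu]_u (sob_ip u h)%:E)%E = (sob_ip c h)%:E.

Definition covariance_is (mu : probability sob_borel R) (c : sobolev)
    (C : sobolev -> sobolev) : Prop :=
  forall h k : sobolev,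
    (\int[mu]_u (sob_ip ((u : sobolev) - c)%R h *
                 sob_ip ((u : sobolev) - c)%R k)%:E)%E = (sob_ip (C h) k)%:E.

Definition centered_gaussian (mu : probability sob_borel R)
    (C : sobolev -> sobolev) : Prop :=
  [/\ gaussian_measure mu, mean_is mu 0 & covariance_is mu 0 C].

Definition regularizer (lambda : R) u : R :=
  lambda * \int[leb]_(x in `[a, b]) `|weak_riesz u x|.

End FractionalSobolev.

Section ObservationNoise.
Context (R : realType) (m : nat).
Implicit Types (S : 'M[R]_m) (z : 'cV[R]_m).

Definition spd S : Prop :=
  S^T = S /\ forall z, z != 0 -> 0 < (z^T *m S *m z) ord0 ord0.

(* The positive definite square root of a positive definite S. *)
Definition sqrt_mx S : 'M[R]_m := xget 0 [set Q | spd Q /\ Q *m Q = S].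

Definition norm2 z : R := Num.sqrt (\sum_i z i ord0 ^+ 2).

Definition norm_wrt S z : R := norm2 (invmx (sqrt_mx S) *m z).

Definition potential (X : Type) S (G : X -> 'cV[R]_m) (y : 'cV[R]_m) (u : X) : R :=
  2^-1 * norm_wrt S (G u - y) ^+ 2.

End ObservationNoise.

Local Open Scope charge_scope.

Section Densities.
Context d (T : measurableType d) (R : realType).
Implicit Types (nu mu : probability T R).

Definition density mu nu : T -> \bar R :=
  'd (charge_of_finite_measure mu) '/d nu.

Definition density_propto mu nu (f : T -> R) : Prop :=
  mu `<< nu /\
  exists2 c : R, 0 < c & {ae nu, forall u, density mu nu u = (c * f u)%:E}.

Definition hellinger nu mu mu' : \bar R :=
  sqrte ((2^-1)%:E *
    \int[nu]_u ((sqrte (density mu nu u) - sqrte (density mu' nu u)) ^+ 2))%E.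

End Densities.

(* Main.v *)
Require Import Defs.
From HB Require Import structures.
From mathcomp Require Import all_boot all_order all_algebra.
From mathcomp Require Import all_classical all_reals all_analysis.
From mathcomp Require Import measurable_realfun ring lra.
Set Implicit Arguments.
Unset Strict Implicit.
Unset Printing Implicit Defensive.
Import Order.TTheory GRing.Theory Num.Theory.
Import numFieldNormedType.Exports.
Local Open Scope classical_set_scope.
Local Open Scope ring_scope.

(** The functions f_N u = exp(- Phi u_N - R u_N) and f u = exp(- Phi u - R u)
    all take values in [0, 1], so everything follows from the pointwise
    convergence f_N u --> f u by dominated convergence ([hellinger_cvg0]).
    The reciprocal of a normalization constant is the integral of the
    unnormalized density; these integrals converge, to a limit that is positive
    because it is again the reciprocal of a constant. So the normalized
    densities rho_N converge to rho in L^1(mu0), and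
    (sqrt x - sqrt y)^2 <= |x - y| turns this into Hellinger convergence.

    For the pointwise convergence, u_N --> u in the Sobolev norm, since u_N is
    the best approximation of u by combinations of e_0, ..., e_(N-1) and these
    are complete ([proj_cvg]). All u_N lie in the ball of radius |u|, where the
    local Lipschitz bound on G applies, so Phi u_N --> Phi u ([potential_cvg]).
    The L^1 norm on a bounded interval is dominated by the L^2 norm, which
    gives R u_N --> R u ([regularizer_cvg]).

    The bilinearity of the inner product is where analysis is needed: the weak
    derivative is a chosen function, and it depends linearly on u only because
    it is unique almost everywhere ([is_weak_riesz_unique]). Uniqueness is a
    density statement on test functions. The functions p(psi) with p a
    polynomial divisible by ((X - psi a)(X - psi b))^(n+1) are test functions,
    because D_psi acts on them as the derivative of polynomials. So if v and v'
    are weak derivatives of the same u, then psi' (v - v') w(psi), with w the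
    power above, is orthogonal to every polynomial in psi. Polynomials in psi
    approximate the indicators of the intervals [a, c] boundedly and pointwise
    ([step_poly_cvg]), so this function integrates to zero on each [a, c] and
    vanishes almost everywhere by Lebesgue differentiation. *)

(** * One-sided calculus on a closed interval *)

Section Calculus.
Context (R : realType) (a b : R).
Hypothesis ab : a < b.
Local Notation I := `[a, b]%classic.
Local Notation nbI x := (within I x^').

(** Non-degeneracy of the interval makes each of its points a limit point of the
    rest of it; this is what makes limits, hence derivatives, unique. *)
Lemma within_dnbhs_proper (x : R) : x \in I -> ProperFilter (nbI x).
Proof.
rewrite inE/= in_itv/= => /andP[ax xb].
apply: Build_ProperFilter_ex => P /nbhs_ballP[e /= e0 eP].
pose m := Num.min (e / 2) ((b - a) / 2).
have m0 : 0 < m by rewrite lt_min !divr_gt0// subr_gt0.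
have me : m < e by rewrite gt_min; apply/orP; left; lra.
have mab : m <= (b - a) / 2 by rewrite ge_min lexx orbT.
(* Move away from the nearer endpoint, by at most half the interval. *)
have [xm|xm] := leP x ((a + b) / 2).
  exists (x + m); apply: eP.
  - by rewrite /ball/= opprD addNKr normrN gtr0_norm.
  - by rewrite addrC -subr_eq0 addrK gt_eqF.
  - by rewrite /= in_itv/=; apply/andP; split; lra.
exists (x - m); apply: eP.
- by rewrite /ball/= opprB addrC subrK gtr0_norm.
- by rewrite -subr_eq0 addrAC subrr add0r oppr_eq0 gt_eqF.
- by rewrite /= in_itv/=; apply/andP; split; lra.
Qed.

(** The relational counterpart of [deriv_on], which is a bare [lim] and so has a
    junk value wherever the difference quotient diverges. *)
Definition has_deriv (f : R -> R) (x l : R) : Prop :=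
  diff_quot f x y @[y --> nbI x] --> l.

Lemma has_deriv_unique f x l : x \in I -> has_deriv f x l ->
  deriv_on a b f x = l.
Proof.
by move=> xI fl; have FF := within_dnbhs_proper xI; exact/cvg_lim.
Qed.

Lemma derivable_on_has_deriv f x : x \in I -> derivable_on a b f ->
  has_deriv f x (deriv_on a b f x).
Proof. by move=> xI /(_ x xI). Qed.

Lemma has_deriv_derivable f f' : (forall x, x \in I -> has_deriv f x (f' x)) ->
  derivable_on a b f.
Proof. by move=> ff' x xI; apply/cvg_ex; exists (f' x); exact: ff'. Qed.

Lemma near_within_dnbhs x : \forall y \near nbI x, y \in I /\ y != x.
Proof.
rewrite near_withinE; near=> y => yI; rewrite inE; split => //.
by near: y; exact: nbhs_dnbhs_neq.
Unshelve. all: by end_near. Qed.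

Lemma eq_has_deriv f g x l : {in I, f =1 g} -> x \in I ->
  has_deriv f x l -> has_deriv g x l.
Proof.
move=> fg xI; apply: cvg_trans; apply: near_eq_cvg; near=> y.
have yI : y \in I by near: y; apply: filterS (near_within_dnbhs x) => y [].
by rewrite /diff_quot !fg.
Unshelve. all: by end_near. Qed.

Lemma has_deriv_cvg f x l : x \in I -> has_deriv f x l -> f y @[y --> nbI x] --> f x.
Proof.
move=> xI fl; rewrite -[X in _ --> X]addr0 -(mulr0 l).
have : f x + diff_quot f x y * (y - x) @[y --> nbI x] --> f x + l * 0.
  apply: cvgD; first exact: cvg_cst.
  apply: cvgM => //; rewrite -(subrr x); apply: cvgB; last exact: cvg_cst.
  apply: cvg_within_filter; exact: nbhs_dnbhs.
apply: cvg_trans; apply: near_eq_cvg; near=> y.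
have yx : y != x by near: y; apply: filterS (near_within_dnbhs x) => y [].
by rewrite /diff_quot divfK ?subr_eq0// addrC subrK.
Unshelve. all: by end_near. Qed.

Lemma derivable_on_continuous f : derivable_on a b f -> {within I, continuous f}.
Proof.
move=> df; apply/subspace_continuousP => x xI P Pfx /=.
have xI' : x \in I by rewrite inE.
have fP : \forall y \near x, y != x -> I y -> P (f y) :=
  has_deriv_cvg xI' (derivable_on_has_deriv xI' df) Pfx.
suff : \forall y \near x, I y -> P (f y) by [].
apply: filterS fP => y yP yI.
(* [has_deriv_cvg] speaks of the punctured neighbourhood; the centre is added. *)
have [->|yx] := eqVneq y x; first exact: nbhs_singleton.
exact: yP.
Qed.

Lemma has_deriv_cst c x : has_deriv (cst c) x 0.
Proof.
have : (fun=> 0 : R) @ nbI x --> (0 : R) by exact: cvg_cst.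
apply: cvg_trans; apply: near_eq_cvg; near=> y.
by rewrite /diff_quot subrr mul0r.
Unshelve. all: by end_near. Qed.

Lemma has_derivD f g x k l : has_deriv f x k -> has_deriv g x l ->
  has_deriv (fun t => f t + g t) x (k + l).
Proof.
move=> fk gl.
have : diff_quot f x y + diff_quot g x y @[y --> nbI x] --> k + l by exact: cvgD.
apply: cvg_trans; apply: near_eq_cvg; near=> y.
by rewrite /diff_quot/= -mulrDl; congr (_ / _); ring.
Unshelve. all: by end_near. Qed.

Lemma has_derivM f g x k l : x \in I -> has_deriv f x k -> has_deriv g x l ->
  has_deriv (fun t => f t * g t) x (k * g x + f x * l).
Proof.
move=> xI fk gl.
have : diff_quot f x y * g y + f x * diff_quot g x y @[y --> nbI x] -->
    k * g x + f x * l.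
  apply: cvgD; first by apply: cvgM => //; exact: has_deriv_cvg gl.
  by apply: cvgM => //; exact: cvg_cst.
apply: cvg_trans; apply: near_eq_cvg; near=> y.
by rewrite /diff_quot; ring.
Unshelve. all: by end_near. Qed.

Lemma has_deriv_poly (p : {poly R}) f x l : x \in I -> has_deriv f x l ->
  has_deriv (fun t => p.[f t]) x (p^`().[f x] * l).
Proof.
move=> xI fl; elim/poly_ind: p => [|p c ih].
  rewrite deriv0 horner0 mul0r; apply: (eq_has_deriv _ _ (has_deriv_cst 0 x)) => //.
  by move=> t _; rewrite horner0.
have := has_derivD (has_derivM xI ih fl) (has_deriv_cst c x).
rewrite derivD derivM derivX derivC !hornerE ?addr0 ?mulr1.
rewrite (_ : (p^`()).[f x] * l * f x + p.[f x] * l =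
  ((p^`()).[f x] * f x + p.[f x]) * l); last by ring.
by apply: (eq_has_deriv _ xI) => t _; rewrite !hornerE.
Qed.

Lemma eq_deriv_on f g : {in I, f =1 g} -> derivable_on a b f ->
  {in I, deriv_on a b f =1 deriv_on a b g}.
Proof.
move=> fg df x xI; apply/esym/has_deriv_unique => //.
exact: eq_has_deriv fg xI (derivable_on_has_deriv xI df).
Qed.

Lemma eq_derivable_on f g : {in I, f =1 g} -> derivable_on a b f -> derivable_on a b g.
Proof.
move=> fg df; apply: (@has_deriv_derivable _ (deriv_on a b f)) => x xI.
exact: eq_has_deriv fg xI (derivable_on_has_deriv xI df).
Qed.

Lemma eq_Cn k f g : {in I, f =1 g} -> Cn a b k f -> Cn a b k g.
Proof.
elim: k f g => [|k ih] f g fg /=.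
  exact: (subspace_eq_continuous fg).
move=> [df cf]; split; first exact: eq_derivable_on fg df.
by apply: ih cf; exact: eq_deriv_on.
Qed.

Lemma CnW k f : Cn a b k.+1 f -> Cn a b k f.
Proof.
elim: k f => [|k ih] f /=; first by case=> /derivable_on_continuous.
by move=> [df cf]; split => //; exact: ih.
Qed.

Lemma Cn_cst k c : Cn a b k (cst c).
Proof.
elim: k c => [|k ih] c /=; first by move=> x; exact: cst_continuous.
have dc x : x \in I -> has_deriv (cst c) x (cst 0 x) by move=> _; exact: has_deriv_cst.
split; first exact: has_deriv_derivable dc.
by apply: eq_Cn (ih 0) => x xI; apply/esym/has_deriv_unique => //; exact: dc.
Qed.

Lemma CnD k f g : Cn a b k f -> Cn a b k g -> Cn a b k (fun t => f t + g t).
Proof.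
elim: k f g => [|k ih] f g /=.
  by move=> /subspace_continuousP cf /subspace_continuousP cg;
     apply/subspace_continuousP => x xI; apply: cvgD; [exact: cf|exact: cg].
move=> [df cf] [dg cg].
have d x : x \in I -> has_deriv (fun t => f t + g t) x
    (deriv_on a b f x + deriv_on a b g x).
  by move=> xI; apply: has_derivD; exact: derivable_on_has_deriv.
split; first exact: has_deriv_derivable d.
apply: eq_Cn (ih _ _ cf cg) => x xI.
by apply/esym/has_deriv_unique => //; exact: d.
Qed.

Lemma CnM k f g : Cn a b k f -> Cn a b k g -> Cn a b k (fun t => f t * g t).
Proof.
elim: k f g => [|k ih] f g.
  by move=> /subspace_continuousP cf /subspace_continuousP cg;
     apply/subspace_continuousP => x xI; apply: cvgM; [exact: cf|exact: cg].
move=> fk gk; have [df cf] := fk; have [dg cg] := gk.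
have d x : x \in I -> has_deriv (fun t => f t * g t) x
    (deriv_on a b f x * g x + f x * deriv_on a b g x).
  by move=> xI; apply: has_derivM => //; exact: derivable_on_has_deriv.
split; first exact: has_deriv_derivable d.
apply: eq_Cn (CnD (ih _ _ cf (CnW gk)) (ih _ _ (CnW fk) cg)) => x xI.
by apply/esym/has_deriv_unique => //; exact: d.
Qed.

Lemma Cn_poly k f (p : {poly R}) : Cn a b k f -> Cn a b k (fun t => p.[f t]).
Proof.
move=> fk; elim/poly_ind: p => [|p c ih].
  by apply: eq_Cn (Cn_cst k 0) => t _; rewrite horner0.
by apply: eq_Cn (CnD (CnM ih fk) (Cn_cst k c)) => t _; rewrite !hornerE.
Qed.

(** The chain rule gives p(psi)' = p'(psi) psi', and dividing by psi' leaves
    p'(psi): on polynomials in psi, D_psi is the formal derivative. *)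
Lemma Dpsi_poly (psi : R -> R) (p : {poly R}) k :
  derivable_on a b psi -> {in I, forall x, deriv_on a b psi x != 0} ->
  {in I, iter k (Dpsi a b psi) (fun t => p.[psi t]) =1 fun t => (p^`(k)).[psi t]}.
Proof.
move=> dpsi psi'0; elim: k => [|k ih] x xI; first by rewrite derivn0.
rewrite iterS {1}/Dpsi derivnS.
have d := has_deriv_poly (p := p^`(k)) xI (derivable_on_has_deriv xI dpsi).
suff -> : deriv_on a b (iter k (Dpsi a b psi) (fun t => p.[psi t])) x =
  (p^`(k)^`()).[psi x] * deriv_on a b psi x by rewrite mulfK ?psi'0.
apply: has_deriv_unique => //; apply: eq_has_deriv xI d.
by move=> t tI; rewrite ih.
Qed.

Lemma root_derivn_exp (c : R) (q : {poly R}) n i : (i <= n)%N ->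
  ((('X - c%:P) ^+ n.+1 * q)^`(i)).[c] = 0.
Proof.
(* Each derivation costs one power of X - c; the multiplicity left over is m. *)
suff h : forall j m, exists r : {poly R},
    ((('X - c%:P) ^+ (j + m) * q)^`(j)) = ('X - c%:P) ^+ m * r.
  move=> le_in; have [r] := h i (n.+1 - i)%N.
  rewrite subnKC ?leqW// subSn// => ->.
  by rewrite exprS !hornerE subrr !mul0r.
elim=> [|j ih] m; first by exists q; rewrite derivn0.
have [r hr] := ih m.+1; exists (m.+1%:R *: r + ('X - c%:P) * r^`()).
rewrite addSnnS derivnS hr derivM deriv_exp derivXsubC mul1r /=.
by rewrite mulrDr scaler_nat mulrnAr mulrnAl mulrA -exprSr.
Qed.

(** A supply of test functions that is stable under multiplication by
    polynomials in psi. The exponent exceeds the order of the derivatives that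
    have to vanish at the endpoints. *)
Lemma test_fun_poly (psi : R -> R) n (q : {poly R}) :
  Cn a b n.+1 psi -> {in I, forall x, deriv_on a b psi x != 0} ->
  test_fun a b psi n.+1
    (fun t => ((('X - (psi a)%:P) * ('X - (psi b)%:P)) ^+ n.+2 * q).[psi t]).
Proof.
move=> cpsi psi'0; split; first exact: Cn_poly.
have [dpsi _] := cpsi.
have aI : a \in I by rewrite inE/= in_itv/= lexx ltW.
have bI : b \in I by rewrite inE/= in_itv/= lexx ltW.
move=> i le_in; rewrite !Dpsi_poly//; split.
  by rewrite exprMn -mulrA root_derivn_exp.
by rewrite mulrC exprMn mulrCA mulrA mulrC root_derivn_exp.
Qed.

End Calculus.

(** * Almost everywhere equality and integrals over an interval *)

Section HasIntegral.
Context (R : realType) (a b : R).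
Local Notation leb := (@lebesgue_measure R).
Local Notation I := `[a, b]%classic.
Let mI : measurable (I : set (measurableTypeR R)). Proof. by []. Qed.
Let FF := @ae_filter_ringOfSetsType _ _ R leb.

Lemma ae_eq_Rintegral (f g : R -> R) :
  measurable_fun I f -> measurable_fun I g ->
  {ae leb, forall x, x \in I -> f x = g x} ->
  \int[leb]_(x in I) f x = \int[leb]_(x in I) g x.
Proof.
move=> mf mg fg; congr fine; apply: ae_eq_integral => //.
- exact/measurable_EFinP.
- exact/measurable_EFinP.
- by apply: (@filterS _ _ FF _ _ _ fg) => x fgx xI; congr EFin; apply: fgx; rewrite inE.
Qed.

Lemma has_integral_unique (f : R -> R) l l' :
  has_integral a b f l -> has_integral a b f l' -> l = l'.
Proof.
move=> [h [hi fh <-]] [h' [hi' fh' <-]]; apply: ae_eq_Rintegral.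
- apply/measurable_EFinP; exact: measurable_int hi.
- apply/measurable_EFinP; exact: measurable_int hi'.
- by apply: (@filterS2 _ _ FF _ _ _ _ fh fh') => x fx fx' xI; rewrite -fx// -fx'.
Qed.

End HasIntegral.

(** * A function orthogonal to all polynomials in a monotone function *)

Section Moments.
Context (R : realType).
Local Notation leb := (@lebesgue_measure R).

Definition step_mult (c : R) (k : nat) : nat := (Num.truncn (c^-1 ^+ k)).+1.

(** Polynomial approximations of a step at c on [0, 1]. With M close to c^-k,
    (1 - s^k)^M behaves like exp(- (s / c)^k), so it tends to 1 for s < c and
    to 0 for s > c. *)
Definition step_poly (c : R) (k : nat) : {poly R} := (1 - 'X^k) ^+ step_mult c k.

Lemma bernoulli_le (t : R) n : -1 <= t -> 1 + n%:R * t <= (1 + t) ^+ n.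
Proof.
move=> t1; elim: n => [|n ih]; first by rewrite mul0r addr0 expr0.
rewrite exprS -natr1.
have n0 : 0 <= n%:R :> R by [].
have t1' : 0 <= 1 + t by lra.
apply: le_trans (ler_wpM2l t1' ih).
have := sqr_ge0 t; nra.
Qed.

Lemma step_poly_ge0_le1 c k (s : R) : 0 <= s <= 1 -> 0 <= (step_poly c k).[s] <= 1.
Proof.
move=> /andP[s0 s1]; rewrite /step_poly !hornerE.
have sk0 : 0 <= s ^+ k by exact: exprn_ge0.
have sk1 : s ^+ k <= 1 by exact: exprn_ile1.
by rewrite exprn_ge0 ?exprn_ile1//; lra.
Qed.

(** Both halves come from Bernoulli's inequality: for s < c it gives
    (1 - s^k)^M >= 1 - M s^k >= 1 - 2 (s / c)^k, and for s > c it gives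
    (1 - s^k)^M <= 1 / (1 + M s^k) <= (c / s)^k, through
    (1 - s^k)^M (1 + s^k)^M <= 1. *)
Lemma step_poly_cvg c (s : R) : 0 < c < 1 -> 0 <= s <= 1 -> s != c ->
  (step_poly c k).[s] @[k --> \oo] --> ((s <= c)%R%:R : R).
Proof.
move=> /andP[c0 c1] s01; have /andP[s0 s1] := s01.
have ck0 k : 0 <= c^-1 ^+ k by rewrite exprn_ge0// invr_ge0 ltW.
have ck1 k : 1 <= c^-1 ^+ k by rewrite exprn_ege1// -invr1 lef_pV2 ?posrE// ltW.
have Mlb k : c^-1 ^+ k <= (step_mult c k)%:R.
  by have /andP[_ /ltW] := truncn_itv (ck0 k).
have Mub k : (step_mult c k)%:R <= 2 * c^-1 ^+ k.
  have /andP[h _] := truncn_itv (ck0 k).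
  by rewrite /step_mult -natr1; have := ck1 k; lra.
have sk0 k : 0 <= s ^+ k by exact: exprn_ge0.
have sk1 k : s ^+ k <= 1 by exact: exprn_ile1.
have pE k : (step_poly c k).[s] = (1 - s ^+ k) ^+ step_mult c k.
  by rewrite /step_poly !hornerE.
rewrite neq_lt => /orP[sc|cs].
  rewrite ltW//.
  apply: (@squeeze_cvgr _ _ _ _ (fun k => 1 - 2 * (s / c) ^+ k) (cst 1)).
  - apply: nearW => k; have /andP[_ ->] := step_poly_ge0_le1 c k s01.
    rewrite andbT pE; apply: le_trans (bernoulli_le _ _); last first.
        by have := sk1 k; lra.
      rewrite expr_div_n -exprVn.
      have := ler_wpM2r (sk0 k) (Mub k); lra.
  - rewrite -[X in _ --> X]subr0 -[X in _ - X](mulr0 2).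
    apply: cvgB; first exact: cvg_cst.
    apply: cvgMl_tmp; apply: cvg_expr.
    by rewrite ger0_norm ?divr_ge0 ?(ltW c0)// ltr_pdivrMr// mul1r.
  - exact: cvg_cst.
rewrite leNgt cs /=.
have s00 : 0 < s by lra.
apply: (@squeeze_cvgr _ _ _ _ (cst 0) (fun k => (c / s) ^+ k)).
- apply: nearW => k; have /andP[-> _] /= := step_poly_ge0_le1 c k s01.
  rewrite pE; set M := step_mult c k.
  have h : (1 - s ^+ k) ^+ M * (1 + M%:R * s ^+ k) <= 1.
    apply: (@le_trans _ _ ((1 - s ^+ k) ^+ M * (1 + s ^+ k) ^+ M)).
      rewrite ler_wpM2l// ?exprn_ge0 ?subr_ge0//.
      by apply: bernoulli_le; have := sk0 k; lra.
    rewrite -exprMn exprn_ile1//; have := sk0 k; have := sk1 k; nra.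
  have p0 : 0 <= (1 - s ^+ k) ^+ M by rewrite exprn_ge0 ?subr_ge0.
  have : (1 - s ^+ k) ^+ M * (s / c) ^+ k <= 1.
    apply: le_trans h; rewrite ler_wpM2l//.
    rewrite expr_div_n -exprVn.
    have := ler_wpM2r (sk0 k) (Mlb k); rewrite -/M; lra.
  have sck : 0 < (s / c) ^+ k by rewrite exprn_gt0 ?divr_gt0.
  by rewrite -ler_pdivlMr// div1r -exprVn invf_div.
- exact: cvg_cst.
- apply: cvg_expr.
  by rewrite ger0_norm ?divr_ge0 ?(ltW c0)// ltr_pdivrMr// mul1r.
Qed.

Lemma ae_neq (c : R) : {ae leb, forall x, x != c}.
Proof.
exists [set c]; split => //; first exact: lebesgue_measure_set1.
by move=> x /= /negP; rewrite negbK => /eqP.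
Qed.

Variables (a b : R).
Hypothesis ab : a < b.
Local Notation I := `[a, b]%classic.

(** The primitive of h is zero on the interior, hence so is its derivative,
    which is h at almost every point. *)
Lemma zero_integrals_ae (h : R -> R) : leb.-integrable I (EFin \o h) ->
  (forall c, a < c < b -> \int[leb]_(x in `[a, c]) h x = 0) ->
  {ae leb, forall x, x \in I -> h x = 0}.
Proof.
move=> hi h0.
have mI : measurable (I : set (measurableTypeR R)) by [].
(* The differentiation theorem is used for h extended by 0. *)
have hI0 := hi; rewrite (integrable_mkcond _ mI) in hI0.
have hI : leb.-integrable setT (EFin \o (h \_ I)) by move: hI0; rewrite restrict_EFin.
pose F y := \int[leb]_(t in [set` Interval (BLeft a) (BRight y)]) (h \_ I) t.
have FF := @ae_filter_ringOfSetsType _ _ R leb.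
have ftc : {ae leb, forall x, a < x ->
    derivable F x 1 /\ F^`()%classic x = (h \_ I) x}.
  have hy y : leb.-integrable [set` Interval (BLeft a) (BRight y)] (EFin \o (h \_ I)).
    exact: integrableS hI.
  have := FTC1 hy (integrable_locally mI hi).
  by apply: filterS => x; rewrite lte_fin.
apply: (@filterS3 _ _ FF _ _ _ _ _ ftc (ae_neq a) (ae_neq b)) => x Fx xa xb.
rewrite inE/= in_itv/= => /andP[ax xb'].
have {}ax : a < x by rewrite lt_neqAle eq_sym xa.
have {}xb : x < b by rewrite lt_neqAle xb.
have hx : (h \_ I) x = h x by rewrite patchE mem_set//= in_itv/= !ltW.
have [_] := Fx ax.
rewrite hx => <-.
rewrite derive1E (@near_eq_derive _ _ _ F (cst 0)) ?derive_cst//.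
have : \forall y \near x, y \in `]a, b[ by apply: near_in_itvoo; rewrite in_itv/= ax.
apply: filterS => y; rewrite in_itv/= => /andP[ay yb].
rewrite /F -[RHS](h0 y) ?ay//; apply: eq_Rintegral => t; rewrite inE/= in_itv/= => /andP[at_ ty].
by rewrite patchE mem_set//= in_itv/= at_ (le_trans ty)// ltW.
Qed.

(** Test h against the step polynomials at s c: by monotonicity of s these
    converge to the indicator of [a, c] off the point c, and dominated
    convergence with bound |h| shows that h integrates to 0 on [a, c]. *)
Lemma zero_moments_ae (h s : R -> R) :
  leb.-integrable I (EFin \o h) -> {within I, continuous s} ->
  {in I &, {homo s : x z / x < z}} -> s a = 0 -> s b = 1 ->
  (forall q : {poly R}, has_integral a b (fun x => h x * q.[s x]) 0) ->
  {ae leb, forall x, x \in I -> h x = 0}.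
Proof.
move=> hi cs ms sa sb mom; apply: zero_integrals_ae => // c /andP[ac cb].
have aI : a \in I by rewrite inE/= in_itv/= lexx ltW.
have bI : b \in I by rewrite inE/= in_itv/= lexx ltW.
have cI : c \in I by rewrite inE/= in_itv/= !ltW.
have sc01 : 0 < s c < 1 by rewrite -{1}sa -sb !ms.
have s01 x : x \in I -> 0 <= s x <= 1.
  move=> xI; have := xI; rewrite inE/= in_itv/= => /andP[].
  rewrite le_eqVlt => /predU1P[<- _|ax]; first by rewrite sa lexx ler01.
  rewrite le_eqVlt => /predU1P[->|xb]; first by rewrite sb lexx ler01.
  by rewrite -{1}sa -sb !ltW// ms.
have mI : measurable (I : set (measurableTypeR R)) by [].
have mp q : measurable_fun I (fun x => q.[s x]).
  apply: subspace_continuous_measurable_fun => //.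
  exact: (@Cn_poly _ _ _ ab 0).
have mh : measurable_fun I h by apply/measurable_EFinP; exact: measurable_int hi.
pose f k x := h x * (step_poly (s c) k).[s x].
pose g x := h x * (x <= c)%R%:R.
have mg : measurable_fun I g.
  apply: measurable_funM => //; rewrite (_ : (fun _ => _) = \1_(`]-oo, c]%classic)).
    exact: measurable_indic.
  by apply/funext => x; rewrite indicE; congr (nat_of_bool _)%:R;
     apply/idP/idP; rewrite inE/= in_itv.
have mf k : measurable_fun I (f k) by exact: measurable_funM.
have fh k x : x \in I -> `|f k x| <= `|h x|.
  move=> xI; rewrite /f normrM ler_piMr//.
  by have /andP[p0 p1] := step_poly_ge0_le1 (s c) k (s01 _ xI); rewrite ger0_norm.
have mEf k : measurable_fun I (EFin \o f k) by exact/measurable_EFinP.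
have mEg : measurable_fun I (EFin \o g) by exact/measurable_EFinP.
have FF := @ae_filter_ringOfSetsType _ _ R leb.
have [gi _ fg] : [/\ leb.-integrable I (EFin \o g),
    (\int[leb]_(x in I) `|(f k x)%:E - (g x)%:E| @[k --> \oo] --> 0)%E &
    (\int[leb]_(x in I) (f k x)%:E @[k --> \oo] --> \int[leb]_(x in I) (g x)%:E)%E].
  apply: (@dominated_convergence _ _ _ leb I mI (fun k => EFin \o f k)
    (EFin \o g) (abse \o (EFin \o h))) => //.
  (* The step polynomials may fail to converge at c. *)
  - apply: (@filterS _ _ FF _ _ _ (ae_neq c)) => x xc xI.
    apply: cvg_EFin; first exact: nearW.
    have xI' : x \in I by rewrite inE.
    apply: cvgMl_tmp.
    have sxc : s x != s c.
      by move: xc; rewrite !neq_lt => /orP[xc|cx]; apply/orP; [left|right]; exact: ms.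
    have -> : (x <= c) = (s x <= s c).
      move: xc; rewrite neq_lt => /orP[xc|cx]; first by rewrite !ltW// ms.
      by rewrite !leNgt cx ms.
    exact: step_poly_cvg (s01 _ xI') sxc.
  - exact: integrable_abse.
  - by apply: aeW => x k xI; rewrite lee_fin fh// inE.
have f0 k : (\int[leb]_(x in I) (f k x)%:E = 0)%E.
  have fi : leb.-integrable I (EFin \o f k).
    apply: (le_integrable mI _ _ hi).
      exact: mEf.
    by move=> x xI; rewrite lee_fin fh// inE.
  rewrite -(fineK (integrable_fin_num mI fi)); congr EFin.
  apply: (has_integral_unique _ (mom (step_poly (s c) k))).
  by exists (f k); split; [exact: fi|exact: aeW|].
have g0 : (\int[leb]_(x in I) (g x)%:E = 0)%E.
  apply/esym; rewrite -(cvg_lim _ fg)//; under eq_fun do rewrite f0.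
  by rewrite lim_cst.
have : \int[leb]_(x in I) g x = 0 by rewrite /Rintegral g0.
rewrite (_ : `[a, c]%classic = I `&` `]-oo, c]) ?Rintegral_mkcondr.
  move=> <-; apply: eq_Rintegral => x xI; rewrite patchE /g.
  have -> : (x \in `]-oo, c]%classic) = (x <= c).
    by apply/idP/idP; rewrite inE/= in_itv.
  by case: (x <= c); rewrite ?mulr1 ?mulr0.
apply/seteqP; split => x /=; rewrite !in_itv/=.
  by move=> /andP[-> xc] /=; split => //; rewrite (le_trans xc)// ltW.
by move=> [/andP[-> _] ->].
Qed.

End Moments.

(** * Square-integrable functions on an interval *)

Section IntervalIntegrals.
Context (R : realType) (a b : R).
Local Notation leb := (@lebesgue_measure R).
Local Notation I := `[a, b]%classic.
Let mI : measurable (I : set (measurableTypeR R)). Proof. by []. Qed.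

Lemma L2_measurable (u : L2 a b) : measurable_fun [set: R] (u : R -> R).
Proof. exact: (@ae_class_measurable _ _ _ _ (\val u)). Qed.

Lemma L2_measurable_on (u : L2 a b) : measurable_fun I (u : R -> R).
Proof. exact: measurable_funS (L2_measurable u). Qed.

(** Transfers Hoelder's inequality from the measure restricted to the interval,
    on which the space L2 is built, to integrals over the interval. *)
Lemma L2_integrable_mul (u v : L2 a b) :
  leb.-integrable I (EFin \o (fun x => u x * v x)).
Proof.
have uL : (u : R -> R) \in Lfun (lebesgue_on a b) 2%:E by apply: Lspace_Lfun; exact: valP.
have vL : (v : R -> R) \in Lfun (lebesgue_on a b) 2%:E by apply: Lspace_Lfun; exact: valP.
have /Lfun1_integrable uv := Lfun2_mul_Lfun1 uL vL.
have /integrableP[muv fin_uv] := integrableS measurableT mI (@subsetT _ _) uv.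
apply/integrableP; split => //.
apply: le_lt_trans fin_uv; rewrite le_eqVlt; apply/orP; left; apply/eqP.
apply: eq_measure_integral => A mA AI.
by rewrite /lebesgue_on/= /mrestr setIidl.
Qed.

Lemma itv_integrable_cst (c : R) : leb.-integrable I (EFin \o (cst c)).
Proof.
apply: measurable_bounded_integrable => //.
  by rewrite /= lebesgue_measure_itv/=; case: ifP => // _; rewrite -EFinB ltry.
exists `|c|; split; first exact: num_real.
by move=> x cx y _ /=; exact: ltW.
Qed.

(** A form of the Cauchy-Schwarz inequality. Integrating |f| <= t + f^2 / t
    bounds the integral of |f| by t (b - a) + n^2 / t for every t > 0, and t
    may approach n. The value t = n itself is excluded when n = 0. *)
Lemma integral_norm_le_sqr (f : R -> R) (n : R) : a < b -> 0 <= n -> measurable_fun I f ->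
  leb.-integrable I (EFin \o (fun x => f x * f x)) ->
  \int[leb]_(x in I) (f x * f x) <= n ^+ 2 ->
  leb.-integrable I (EFin \o f) /\
  \int[leb]_(x in I) `|f x| <= n * (b - a + 1).
Proof.
move=> ab n0 mf ffi ffn.
have ci c : leb.-integrable I (EFin \o (cst c)) := itv_integrable_cst c.
have bnd (t x : R) : 0 < t -> `|f x| <= t + t^-1 * (f x * f x).
  move=> t0; rewrite -(ler_pM2l t0) mulrDr mulVKf ?gt_eqF//.
  have -> : f x * f x = `|f x| * `|f x| by rewrite -normrM ger0_norm// -expr2 sqr_ge0.
  have := normr_ge0 (f x); nra.
have cffi c d : leb.-integrable I (EFin \o (fun x => c + d * (f x * f x))).
  have := integrableD mI (ci c) (integrableZl mI d ffi).
  by apply: eq_integrable => // x _; rewrite /= EFinD EFinM.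
have fi : leb.-integrable I (EFin \o f).
  apply: (le_integrable mI _ _ (cffi 1 1)) => [|x _]; first exact/measurable_EFinP.
  rewrite /= lee_fin (le_trans (bnd 1 x ltr01))// invr1.
  exact: ler_norm.
split => //.
have K0 : 0 < b - a + 1 by rewrite addr_gt0// subr_gt0.
apply/ler_addgt0Pr => eps e0.
pose dl := eps / (b - a + 1); have dl0 : 0 < dl by rewrite divr_gt0.
have t0 : 0 < n + dl by rewrite ltr_wpDl.
apply: (@le_trans _ _ (\int[leb]_(x in I) (n + dl + (n + dl)^-1 * (f x * f x)))).
  apply: le_Rintegral => //; last by move=> x _; exact: bnd.
  exact: integrable_norm.
have i2 : leb.-integrable I (EFin \o (fun x => (n + dl)^-1 * (f x * f x))) :=
  integrableZl mI (n + dl)^-1 ffi.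
rewrite (RintegralD mI (ci (n + dl)) i2).
rewrite RintegralZl// Rintegral_cst//.
have -> : fine (leb I) = b - a.
  by rewrite lebesgue_measure_itv/= lte_fin ab -EFinB.
have -> : n * (b - a + 1) + eps = (n + dl) * (b - a) + (n + dl).
  rewrite /dl; field; lra.
rewrite lerD2l ler_pdivrMl// (le_trans ffn)//; nra.
Qed.

End IntervalIntegrals.

(** * Uniqueness of the weak derivative *)

Section WeakDerivative.
Context (R : realType) (a b alpha : R) (psi : R -> R).
Hypothesis ab : a < b.
Hypothesis psiC : Cn a b (frac_order alpha) psi.
Hypothesis psi_incr : {in `[a, b] &, {homo psi : x z / x < z}}.
Hypothesis psi'0 : {in `[a, b], forall x, deriv_on a b psi x != 0}.
Local Notation leb := (@lebesgue_measure R).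
Local Notation I := `[a, b]%classic.
Let mI : measurable (I : set (measurableTypeR R)). Proof. by []. Qed.
Let FF := @ae_filter_ringOfSetsType _ _ R leb.

Let inI x : (x \in I) = (x \in `[a, b]). Proof. by apply/idP/idP; rewrite inE. Qed.

Lemma psi_zero_moments_ae (h : R -> R) : leb.-integrable I (EFin \o h) ->
  (forall q : {poly R}, has_integral a b (fun x => h x * q.[psi x]) 0) ->
  {ae leb, forall x, x \in I -> h x = 0}.
Proof.
move=> hi mom.
have cpsi : {within I, continuous psi} by have [/derivable_on_continuous] := psiC.
pose d := psi b - psi a.
have d0 : 0 < d by rewrite subr_gt0 psi_incr// !in_itv/= ?lexx ltW.
(* l is the affine map that sends psi a to 0 and psi b to 1. *)
pose l : {poly R} := d^-1 *: ('X - (psi a)%:P).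
have lE x : l.[psi x] = (psi x - psi a) / d by rewrite !hornerE mulrC.
apply: (@zero_moments_ae _ _ _ ab h (fun x => l.[psi x])) => //.
- exact: (@Cn_poly _ _ _ ab 0).
- by move=> x y; rewrite !inI => xI yI xy; rewrite !lE ltr_pM2r ?invr_gt0// ltrD2r psi_incr.
- by rewrite lE subrr mul0r.
- by rewrite lE divff ?gt_eqF.
move=> q; have [g [gi gE g0]] := mom (q \Po l).
by exists g; split => //; apply: (@filterS _ _ FF _ _ _ gE) => x; rewrite horner_comp.
Qed.

(** The defining identity determines the integral of psi' v g for each test
    function g, so psi' (v - v') W(psi) is orthogonal to all polynomials in psi,
    where W carries the boundary conditions. On the open interval psi' and
    W(psi) do not vanish. *)
Lemma is_weak_riesz_unique (u v v' : R -> R) :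
  is_weak_riesz a b psi alpha u v -> is_weak_riesz a b psi alpha u v' ->
  {ae leb, forall x, x \in I -> v x = v' x}.
Proof.
move=> uv uv'.
pose W : {poly R} := (('X - (psi a)%:P) * ('X - (psi b)%:P)) ^+ (frac_order alpha).+1.
pose w q := W * q.
have psi'0I : {in I, forall x, deriv_on a b psi x != 0}.
  by move=> x; rewrite inI; exact: psi'0.
have wint q : has_integral a b
    (fun x => deriv_on a b psi x * (v x - v' x) * (w q).[psi x]) 0.
  have gt : test_fun a b psi (frac_order alpha) (fun t => (w q).[psi t]).
    exact: test_fun_poly.
  have [lu [lv [iu iv luv]]] := uv _ gt.
  have [lu' [lv' [iu' iv' luv']]] := uv' _ gt.
  have lvv : lv' = lv.
    have := has_integral_unique iu iu'; rewrite luv luv' => /esym.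
    by apply: mulfI; rewrite signr_eq0.
  rewrite -(subrr lv) addrC -[- lv]mulN1r -[in - 1 * lv]lvv.
  apply: has_integral_linear iv' iv.
  by apply: aeW => x _; ring.
have [h0 [h0i h0E _]] := wint 1.
have h00 : {ae leb, forall x, x \in I -> h0 x = 0}.
  apply: psi_zero_moments_ae => // q.
  have [hq [hqi hqE hq0]] := wint q.
  exists hq; split => //.
  apply: (@filterS2 _ _ FF _ _ _ _ h0E hqE) => x h0x hqx xI.
  by rewrite -h0x// -hqx// /w mulr1 (hornerM W q) mulrA.
have neq : {ae leb, forall x, x != a /\ x != b}.
  by apply: (@filterS2 _ _ FF _ _ _ _ (ae_neq a) (ae_neq b)) => x.
apply: (@filterS3 _ _ FF _ _ _ _ _ h00 h0E neq) => x h00x h0x [xa xb] xI.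
have := h0x xI; rewrite h00x// => /eqP; rewrite !mulf_eq0 (negbTE (psi'0I _ xI))/=.
rewrite subr_eq0 => /orP[/eqP//|].
rewrite /w mulr1 /W horner_exp !hornerE expf_eq0/= mulf_eq0 !subr_eq0.
have := xI; rewrite inE/= in_itv/= => /andP[ax xb'].
have {}ax : a < x by rewrite lt_neqAle eq_sym xa.
have {}xb : x < b by rewrite lt_neqAle xb.
by rewrite gt_eqF ?lt_eqF// psi_incr// in_itv/= ?lexx ?ltW.
Qed.
End WeakDerivative.

(** * Orthogonal projection in a pre-Hilbert space *)

Section InnerProduct.
Context (R : realType) (V : lmodType R) (ip : V -> V -> R).
Hypothesis ipC : forall u v, ip u v = ip v u.
Hypothesis ip_linear : forall c u v w, ip (c *: u + v) w = c * ip u w + ip v w.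
Hypothesis ip_ge0 : forall u, 0 <= ip u u.
Variable e : nat -> V.
Hypothesis e_orth : forall i j, ip (e i) (e j) = (i == j)%:R.

Let ip0 w : ip 0 w = 0.
Proof. by have := ip_linear 1 0 0 w; rewrite scaler0 addr0 mul1r; lra. Qed.

Let ipN v w : ip (- v) w = - ip v w.
Proof. by have := ip_linear (-1) v 0 w; rewrite scaleN1r addr0 ip0 addr0 mulN1r. Qed.

Lemma ip_sum (c : nat -> R) N w :
  ip (\sum_(k < N) c k *: e k) w = \sum_(k < N) c k * ip (e k) w.
Proof.
elim: N => [|N ih]; first by rewrite !big_ord0 ip0.
by rewrite !big_ord_recr/= addrC ip_linear ih addrC.
Qed.

Lemma ip_sum_sum (c : nat -> R) N :
  ip (\sum_(k < N) c k *: e k) (\sum_(k < N) c k *: e k) = \sum_(k < N) c k ^+ 2.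
Proof.
rewrite ip_sum; apply: eq_bigr => k _.
rewrite ipC ip_sum (bigD1 k)//= e_orth eqxx mulr1 big1 ?addr0// => i ik.
by rewrite e_orth (_ : (_ == _) = false) ?mulr0//; exact/negbTE.
Qed.

(** Pythagoras: the Fourier coefficients minimize the distance to the span of
    the first N vectors, and the minimum is nonincreasing in N. *)
Lemma ip_sub_sum u (c : nat -> R) N :
  ip (u - \sum_(k < N) c k *: e k) (u - \sum_(k < N) c k *: e k) =
  ip u u - \sum_(k < N) ip u (e k) ^+ 2 + \sum_(k < N) (c k - ip u (e k)) ^+ 2.
Proof.
set s := \sum_(k < N) c k *: e k.
have su : ip s u = \sum_(k < N) c k * ip u (e k).
  by rewrite ip_sum; apply: eq_bigr => k _; rewrite ipC.
have ss := ip_sum_sum c N; rewrite -/s in ss.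
have sub v w : ip (v - s) w = ip v w - ip s w.
  by rewrite addrC -scaleN1r ip_linear mulN1r addrC.
rewrite sub (ipC u) (ipC s) !sub (ipC u s) su ss.
have -> : \sum_(k < N) (c k - ip u (e k)) ^+ 2 = \sum_(k < N) c k ^+ 2 -
    (\sum_(k < N) c k * ip u (e k)) * 2 + \sum_(k < N) ip u (e k) ^+ 2.
  by rewrite mulr_suml -sumrB -big_split; apply: eq_bigr => k _ /=; ring.
by ring.
Qed.

Local Notation norm u := (Num.sqrt (ip u u)).
Local Notation proj N u := (\sum_(k < N) ip u (e k) *: e k).

Lemma norm_proj_le N u : norm (proj N u) <= norm u.
Proof.
apply: ler_wsqrtr; rewrite -subr_ge0; have := ip_ge0 (u - proj N u).
rewrite (ip_sub_sum u (fun k => ip u (e k))) (ip_sum_sum (fun k => ip u (e k))).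
by rewrite [X in _ + X]big1 ?addr0 => // k _; rewrite subrr expr0n.
Qed.

(** Some combination of N vectors is eps-close to u. The projection on the first
    n >= N vectors is at least as close, as adding vectors to the span and
    passing to the Fourier coefficients both decrease the distance. *)
Lemma proj_cvg u :
  (forall eps : R, 0 < eps -> exists N (c : nat -> R),
    norm (u - \sum_(k < N) c k *: e k) < eps) ->
  norm (proj N u - u) @[N --> \oo] --> 0.
Proof.
move=> complete; apply/cvgrPdist_lt => eps e0.
have [N [c cN]] := complete _ e0.
near=> n; rewrite sub0r normrN ger0_norm ?sqrtr_ge0//.
apply: le_lt_trans cN; apply: ler_wsqrtr.
have -> : ip (proj n u - u) (proj n u - u) = ip (u - proj n u) (u - proj n u).
  by rewrite -opprB ipN ipC ipN opprK.
rewrite ip_sub_sum (ip_sub_sum u (fun k => ip u (e k))).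
rewrite [X in _ + X <= _]big1 => [|k _]; last by rewrite subrr expr0n.
rewrite addr0 -[leLHS]addr0 lerD//; last by apply: sumr_ge0 => k _; exact: sqr_ge0.
rewrite lerB// (big_ord_widen n (fun k => ip u (e k) ^+ 2)); last by near: n; exists N.
rewrite [leRHS](bigID (fun k : 'I_n => (k < N)%N))/= lerDl.
by apply: sumr_ge0 => k _; exact: sqr_ge0.
Unshelve. all: by end_near. Qed.

End InnerProduct.

(** * The Sobolev space and the continuity of the potential and regularizer *)

Section SobolevSpace.
Context (R : realType) (a b alpha : R) (psi : R -> R).
Hypothesis ab : a < b.
Hypothesis psiC : Cn a b (frac_order alpha) psi.
Hypothesis psi_incr : {in `[a, b] &, {homo psi : x z / x < z}}.
Hypothesis psi'0 : {in `[a, b], forall x, deriv_on a b psi x != 0}.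
Local Notation leb := (@lebesgue_measure R).
Local Notation I := `[a, b]%classic.
Local Notation X := (sobolev a b psi alpha).
Let mI : measurable (I : set (measurableTypeR R)). Proof. by []. Qed.
Let FF := @ae_filter_ringOfSetsType _ _ R leb.
Implicit Types u v : X.

Lemma weak_rieszP u : is_weak_riesz a b psi alpha u (weak_riesz u).
Proof.
have : sobolev_val u \in @weakly_riesz R a b psi alpha by exact: valP.
rewrite inE /= => -[v uv]; rewrite /weak_riesz; by case: xgetP => [w _ //|NP]; have := NP v uv.
Qed.

(** The linear combination of the weak derivatives is a weak derivative of the
    linear combination, hence the chosen one up to a null set. *)
Lemma weak_riesz_linear (c : R) u v :
  {ae leb, forall x, x \in I ->
    weak_riesz (c *: u + v) x = c * weak_riesz u x + weak_riesz v x}.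
Proof.
have cuv : is_weak_riesz a b psi alpha (sobolev_val (c *: u + v))
    (c *: weak_riesz u + weak_riesz v : L2 a b).
  move=> g gt.
  have [lu1 [lv1 [iu1 iv1 l1]]] := weak_rieszP u gt.
  have [lu2 [lv2 [iu2 iv2 l2]]] := weak_rieszP v gt.
  exists (c * lu1 + lu2), (c * lv1 + lv2); split.
  - apply: has_integral_linear iu1 iu2.
    have := L2_scaleD c (sobolev_val u) (sobolev_val v).
    by apply: (@filterS _ _ FF) => x /[apply] /= ->; ring.
  - apply: has_integral_linear iv1 iv2.
    have := L2_scaleD c (weak_riesz u) (weak_riesz v).
    by apply: (@filterS _ _ FF) => x /[apply] /= ->; ring.
  - by rewrite l1 l2; ring.
have h := is_weak_riesz_unique ab psiC psi_incr psi'0 (weak_rieszP (c *: u + v)) cuv.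
have := L2_scaleD c (weak_riesz u) (weak_riesz v).
by apply: (@filterS2 _ _ FF _ _ _ _ h) => x hx h2 xI; rewrite hx// h2.
Qed.

Lemma L2_ip_linear (c : R) (u v t w : L2 a b) :
  {ae leb, forall x, x \in I -> t x = c * u x + v x} ->
  \int[leb]_(x in I) (t x * w x) =
  c * \int[leb]_(x in I) (u x * w x) + \int[leb]_(x in I) (v x * w x).
Proof.
move=> tE; have mL (z : L2 a b) := L2_measurable_on z.
have uw := L2_integrable_mul u w; have vw := L2_integrable_mul v w.
have cuw : leb.-integrable I (EFin \o (fun x => c * (u x * w x))) := integrableZl mI c uw.
rewrite -(RintegralZl c mI uw) -(RintegralD mI cuw vw).
apply: ae_eq_Rintegral.
- exact: measurable_funM.
- by apply: measurable_funD; [apply: measurable_funM => //|]; exact: measurable_funM.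
- by apply: (@filterS _ _ FF _ _ _ tE) => x /[apply] ->; ring.
Qed.

Lemma sob_ip_linear (c : R) u v w : sob_ip (c *: u + v) w = c * sob_ip u w + sob_ip v w.
Proof.
rewrite /sob_ip (L2_ip_linear _ (L2_scaleD c (sobolev_val u) (sobolev_val v))).
by rewrite (L2_ip_linear _ (weak_riesz_linear c u v)); ring.
Qed.

Lemma sob_ipC u v : sob_ip u v = sob_ip v u.
Proof. by rewrite /sob_ip; congr (_ + _); apply: eq_Rintegral => x _; rewrite mulrC. Qed.

Lemma sob_ip_ge0 u : 0 <= sob_ip u u.
Proof. by rewrite addr_ge0// Rintegral_ge0// => x _; rewrite -expr2 sqr_ge0. Qed.

(** The weak derivative is bounded from the Sobolev space to L^2, and L^2 embeds
    in L^1 because the interval is bounded. *)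
Lemma regularizer_diff_le (lambda : R) u v : 0 <= lambda ->
  `|regularizer lambda u - regularizer lambda v| <=
  lambda * (sob_norm (u - v) * (b - a + 1)).
Proof.
move=> l0; rewrite /regularizer -mulrBr normrM ger0_norm// ler_wpM2l//.
pose d := weak_riesz (u - v).
have dE : {ae leb, forall x, x \in I -> d x = weak_riesz u x - weak_riesz v x}.
  have := weak_riesz_linear (-1) v u; rewrite scaleN1r addrC.
  by apply: (@filterS _ _ FF) => x h xI; rewrite /d h// addrC mulN1r.
have mw (z : L2 a b) := L2_measurable_on z.
have [di dle] : leb.-integrable I (EFin \o d) /\
    \int[leb]_(x in I) `|d x| <= sob_norm (u - v) * (b - a + 1).
  apply: integral_norm_le_sqr => //; first exact: sqrtr_ge0.
    exact: L2_integrable_mul.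
  rewrite sqr_sqrtr ?sob_ip_ge0// /sob_ip lerDr.
  by apply: Rintegral_ge0 => x _; rewrite -expr2 sqr_ge0.
have L2i (z : L2 a b) : leb.-integrable I (EFin \o z).
  have zz : 0 <= \int[leb]_(x in I) (z x * z x).
    by apply: Rintegral_ge0 => x _; rewrite -expr2 sqr_ge0.
  have zn : \int[leb]_(x in I) (z x * z x) <=
    Num.sqrt (\int[leb]_(x in I) (z x * z x)) ^+ 2 by rewrite sqr_sqrtr.
  by have [] := integral_norm_le_sqr ab (sqrtr_ge0 _) (mw z) (L2_integrable_mul z z) zn.
have mn (z : L2 a b) : measurable_fun I (fun x => `|z x|) by exact: measurableT_comp.
have ni (z : L2 a b) : leb.-integrable I (EFin \o (fun x => `|z x|)) := integrable_norm (L2i z).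
have nB : leb.-integrable I (EFin \o (fun x => `|weak_riesz u x| - `|weak_riesz v x|)) :=
  integrableB mI (ni _) (ni _).
have Bn : leb.-integrable I (EFin \o (fun x => `|weak_riesz u x - weak_riesz v x|)) :=
  integrable_norm (integrableB mI (L2i _) (L2i _)).
rewrite -RintegralB//; apply: le_trans (le_normr_Rintegral mI nB) _.
apply: le_trans dle.
have -> : \int[leb]_(x in I) `|d x| =
    \int[leb]_(x in I) `|weak_riesz u x - weak_riesz v x|.
  apply: ae_eq_Rintegral; first exact: mn.
    by apply: measurableT_comp => //; exact: measurable_funB.
  by apply: (@filterS _ _ FF _ _ _ dE) => x /[apply] ->.
apply: le_Rintegral => //; first exact: (integrable_norm nB).
by move=> x _; exact: ler_dist_dist.
Qed.

Lemma onb_proj_cvg (e : nat -> X) u : onb e ->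
  sob_norm (onb_proj e N u - u) @[N --> \oo] --> 0.
Proof.
move=> [eo ec].
exact: (proj_cvg sob_ipC sob_ip_linear eo (ec u)).
Qed.

Lemma sob_norm_onb_proj_le (e : nat -> X) N u : onb e ->
  sob_norm (onb_proj e N u) <= sob_norm u.
Proof.
move=> [eo _].
exact: (norm_proj_le sob_ipC sob_ip_linear sob_ip_ge0 eo N u).
Qed.

Lemma regularizer_cvg (lambda : R) (e : nat -> X) u : 0 <= lambda -> onb e ->
  regularizer lambda (onb_proj e N u) @[N --> \oo] --> regularizer lambda u.
Proof.
move=> l0 eonb; apply/subr_cvg0/norm_cvg0P.
apply: (@squeeze_cvgr _ _ _ _ (cst 0)
  (fun N => lambda * (sob_norm (onb_proj e N u - u) * (b - a + 1)))).
- by apply: nearW => N; rewrite normr_ge0 regularizer_diff_le.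
- exact: cvg_cst.
- rewrite -[X in _ --> X](mulr0 lambda) -[X in lambda * X](mul0r (b - a + 1)).
  by apply: cvgMl_tmp; apply: cvgMr_tmp; exact: onb_proj_cvg.
Qed.

(** The projections are no longer than u, so one Lipschitz constant, that of the
    ball of radius |u| + 1, serves for all N. The noise norm is the Euclidean
    norm after a linear map L, so each coordinate of L G(u_N) converges. *)
Lemma potential_cvg m (Sigma : 'M[R]_m) (G : X -> 'cV[R]_m) (y : 'cV[R]_m)
    (e : nat -> X) u : onb e ->
  (forall r : R, 0 < r -> exists2 K : R, 0 < K & forall u1 u2,
    Num.max (sob_norm u1) (sob_norm u2) < r ->
    norm_wrt Sigma (G u1 - G u2) <= K * sob_norm (u1 - u2)) ->
  potential Sigma G y (onb_proj e N u) @[N --> \oo] --> potential Sigma G y u.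
Proof.
move=> eonb GL.
have nu0 : 0 < sob_norm u + 1 by rewrite ltr_wpDl ?sqrtr_ge0.
have [K K0 GK] := GL _ nu0.
set L := invmx (sqrt_mx Sigma).
have sq0 z : 0 <= \sum_i (L *m z) i ord0 ^+ 2 by apply: sumr_ge0 => i _; exact: sqr_ge0.
have potE v : potential Sigma G y v = 2^-1 * \sum_i (L *m (G v - y)) i ord0 ^+ 2.
  by rewrite /potential /norm_wrt /norm2 sqr_sqrtr.
under eq_cvg do rewrite potE.
rewrite potE; apply: cvgMl_tmp; apply: cvg_big => [|i _]; first exact: add_continuous.
suff h : (L *m (G (onb_proj e N u) - y)) i ord0 @[N --> \oo] --> (L *m (G u - y)) i ord0.
  by apply: (@cvgM _ _ _ _ _ _ _ _ h h).
apply/subr_cvg0/norm_cvg0P.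
apply: (@squeeze_cvgr _ _ _ _ (cst 0) (fun N => K * sob_norm (onb_proj e N u - u))).
- apply: nearW => N; rewrite normr_ge0/=.
  apply: le_trans (GK (onb_proj e N u) u _); last first.
    rewrite gt_max; apply/andP; split; last by rewrite ltrDl.
    by rewrite (le_lt_trans (sob_norm_onb_proj_le _ _ eonb))// ltrDl.
  rewrite /norm_wrt /norm2 -/L.
  have -> : (L *m (G (onb_proj e N u) - y)) i ord0 - (L *m (G u - y)) i ord0 =
      (L *m (G (onb_proj e N u) - G u)) i ord0.
    by rewrite !mulmxBr !mxE; ring.
  rewrite -sqrtr_sqr; apply: ler_wsqrtr.
  by rewrite (bigD1 i)//= lerDl sumr_ge0// => j _; exact: sqr_ge0.
- exact: cvg_cst.
- by rewrite -[X in _ --> X](mulr0 K); apply: cvgMl_tmp; exact: onb_proj_cvg.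
Qed.

End SobolevSpace.

(** * Hellinger convergence from pointwise convergence of densities *)

Section Hellinger.
Context d (T : measurableType d) (R : realType).
Implicit Types (nu mu : probability T R) (f : T -> R).

Lemma sqr_sqrtrB_le (x y : R) :
  (Num.sqrt x - Num.sqrt y) ^+ 2 <= `|x - y|.
Proof.
wlog xy : x y / x <= y => [hw|].
  have [/hw//|/ltW/hw] := leP x y.
  by rewrite -sqrrN opprB distrC.
rewrite distrC ger0_norm ?subr_ge0//.
have sx := sqrtr_ge0 x; have sxy : Num.sqrt x <= Num.sqrt y by exact: ler_wsqrtr.
have [y0|y0] := leP 0 y; last first.
  rewrite !ltr0_sqrtr//; last exact: le_lt_trans y0.
  by rewrite subr0 expr0n subr_ge0.
have sy := sqr_sqrtr y0.
have [x0|x0] := leP 0 x.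
  have sx2 := sqr_sqrtr x0.
  rewrite -[X in _ <= X - _]sy -[X in _ <= _ - X]sx2; nra.
by rewrite (ltr0_sqrtr x0) sub0r sqrrN sy lerDl oppr_ge0 ltW.
Qed.

(** Rescaling the Radon-Nikodym derivative gives a measurable version h of the
    unnormalized density f, which is itself only known to agree with a
    measurable function almost everywhere. As the total mass of mu is 1, the
    integral of h is 1 / c. *)
Lemma density_proptoP nu mu f : density_propto mu nu f ->
  exists2 c : R, 0 < c & exists h : T -> R, [/\ nu.-integrable [set: T] (EFin \o h),
    {ae nu, forall u, h u = f u},
    (\int[nu]_u (h u)%:E = c^-1%:E)%E &
    forall u, density mu nu u = (c * h u)%:E].
Proof.
move=> [dom [c c0 cf]]; exists c => //.
have rfin u : density mu nu u \is a fin_num by exact: Radon_Nikodym_fin_num.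
have ri : nu.-integrable setT (density mu nu) by exact: Radon_Nikodym_integrable.
have rE u : density mu nu u = (fine (density mu nu u))%:E by rewrite fineK.
have hE u : density mu nu u = (c * (c^-1 * fine (density mu nu u)))%:E.
  by rewrite mulrA mulfV ?gt_eqF// mul1r -rE.
exists (fun u => c^-1 * fine (density mu nu u)); split.
- rewrite (_ : _ \o _ = (fun u => c^-1%:E * density mu nu u)%E).
    exact: integrableZl.
  by apply/funext => u; rewrite /= rE.
- apply: filterS cf => u ->/=.
  by rewrite mulrA mulVf ?gt_eqF// mul1r.
- under eq_integral do rewrite EFinM -rE.
  have r1 : (\int[nu]_u density mu nu u = 1)%E.
    rewrite -(@Radon_Nikodym_integral _ _ _ (charge_of_finite_measure mu) nu)//.
    exact: probability_setT.
  by rewrite integralZl// r1 mule1.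
- exact: hE.
Qed.

(** Write rho_N = c_N h_N and rho = c h. Dominated convergence gives h_N --> h
    in L^1, hence 1 / c_N --> 1 / c and c_N --> c. The squared distance is at
    most the integral of |rho_N - rho| <= c_N |h_N - h| + |c_N - c| |h|. *)
Lemma hellinger_cvg0 nu mu (muN : nat -> probability T R) f (fN : nat -> T -> R) :
  density_propto mu nu f -> (forall N, density_propto (muN N) nu (fN N)) ->
  (forall N u, 0 <= fN N u <= 1) ->
  (forall u, fN N u @[N --> \oo] --> f u) ->
  hellinger nu mu (muN N) @[N --> \oo] --> 0%E.
Proof.
move=> /density_proptoP[c c0 [h [iH hf ih rh]]] muNP fN01 fNf.
have {muNP}/choice[cN cNP] : forall N, exists c : R, 0 < c /\
    exists h : T -> R, [/\ nu.-integrable [set: T] (EFin \o h),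
    {ae nu, forall u, h u = fN N u},
    (\int[nu]_u (h u)%:E = c^-1%:E)%E &
    forall u, density (muN N) nu u = (c * h u)%:E].
  by move=> N; have [k k0 kP] := density_proptoP (muNP N); exists k.
have cN0 N : 0 < cN N by have [] := cNP N.
have {cNP}/choice[hN hNP] N := (cNP N).2.
have ihN N : nu.-integrable setT (EFin \o hN N) by have [] := hNP N.
have hNf : {ae nu, forall u N, hN N u = fN N u}.
  by apply: ae_foralln => N; have [] := hNP N.
have [_ dist0 ints] : [/\ nu.-integrable setT (EFin \o h),
    (\int[nu]_u `|(hN N u)%:E - (h u)%:E| @[N --> \oo] --> 0)%E &
    (\int[nu]_u (hN N u)%:E @[N --> \oo] --> \int[nu]_u (h u)%:E)%E].
  apply: (@dominated_convergence _ _ _ nu _ _ _ _ (cst 1%E)) => //.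
  - by move=> N; exact: measurable_int (ihN N).
  - exact: measurable_int iH.
  - near=> u => _; rewrite /=; apply: cvg_EFin; first exact: nearW.
    have -> : fine \o (fun N => (hN N u)%:E) = (fun N => fN N u).
      apply/funext => N /=; move: N; near: u; exact: hNf.
    have -> : h u = f u by near: u.
    exact: fNf.
  - exact: finite_measure_integrable_cst.
  - near=> u => N _ /=; have -> : hN N u = fN N u by move: N; near: u; exact: hNf.
    by have /andP[f0 f1] := fN01 N u; rewrite lee_fin ger0_norm.
have cNc : cN N @[N --> \oo] --> c.
  have ciN : (cN N)^-1 @[N --> \oo] --> c^-1.
    rewrite (_ : (fun N => (cN N)^-1) =
                 fine \o (fun N => \int[nu]_u (hN N u)%:E)%E).
      by apply: fine_cvg; rewrite -ih.
    by apply/funext => N /=; have [_ _ -> _] := hNP N.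
  by apply/(@cvgVP _ _ _ _ cN c) => //; rewrite gt_eqF.
have msqrt : measurable_fun setT (@Num.sqrt R).
  by apply: continuous_measurable_fun; exact: sqrt_continuous.
have sqr0 : (\int[nu]_u ((sqrte (density mu nu u) -
    sqrte (density (muN N) nu u)) ^+ 2) @[N --> \oo] --> 0)%E.
  pose D N := (\int[nu]_u `|(hN N u)%:E - (h u)%:E|)%E.
  pose M := (\int[nu]_u `|(h u)%:E|)%E.
  apply: (@squeeze_cvge _ _ _ _ (cst 0%E) _
    (fun N => (cN N)%:E * D N + `|cN N - c|%:E * M)%E).
  - apply: nearW => N; rewrite integral_ge0/=; last by move=> u _; exact: sqre_ge0.
    have mhN : measurable_fun setT (hN N) by apply/measurable_EFinP; exact: measurable_int (ihN N).
    have mh : measurable_fun setT h by apply/measurable_EFinP; exact: measurable_int iH.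
    have mdist : measurable_fun setT (fun u => `|(hN N u)%:E - (h u)%:E|%E).
      by apply: measurableT_comp => //; apply/measurable_EFinP; exact: measurable_funB.
    have mabs : measurable_fun setT (fun u => `|(h u)%:E|%E).
      by apply: measurableT_comp => //; apply/measurable_EFinP.
    rewrite -ge0_integralZl//; last by rewrite lee_fin ltW.
    have d0 u : setT u -> (0 <= (cN N)%:E * `|(hN N u)%:E - (h u)%:E|)%E.
      by move=> _; rewrite mule_ge0// lee_fin ltW.
    have m0 u : setT u -> (0 <= `|cN N - c|%:E * `|(h u)%:E|)%E.
      by move=> _; rewrite mule_ge0.
    have md := measurable_funeM (cN N)%:E mdist.
    have mm := measurable_funeM `|cN N - c|%:E mabs.
    rewrite -ge0_integralZl// -(ge0_integralD _ measurableT d0 md m0 mm).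
    apply: ge0_le_integral => //.
    + by move=> u _; exact: sqre_ge0.
    + have [_ _ _ rhN] := hNP N.
      rewrite (_ : (fun _ => _) = EFin \o
          (fun u => (Num.sqrt (c * h u) - Num.sqrt (cN N * hN N u)) ^+ 2)).
        apply/measurable_EFinP/measurable_funX/measurable_funB;
          apply: (measurableT_comp msqrt); exact: measurable_funM.
      by apply/funext => u; rewrite /= rh rhN /= -EFinB.
    + exact: emeasurable_funD.
    + move=> u _; have [_ _ _ rhN] := hNP N; rewrite rh rhN /=.
      rewrite -!EFinB -!EFinM -EFinD lee_fin -expr2.
      apply: (le_trans (sqr_sqrtrB_le _ _)).
      rewrite distrC (_ : _ - _ = cN N * (hN N u - h u) + (cN N - c) * h u); last by ring.
      by apply: le_trans (ler_normD _ _) _; rewrite !normrM (gtr0_norm (cN0 N)).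
  - exact: cvg_cst.
  - have <- : (c%:E * 0 + `|c - c|%:E * M = 0)%E.
      by rewrite subrr normr0 mule0 mul0e adde0.
    have Mfin : M \is a fin_num.
      by rewrite ge0_fin_numE ?integral_ge0//; have /integrableP[] := iH.
    have Mdef : (`|c - c|%:E *? M)%E by rewrite mule_def_fin.
    have zdef : (c%:E *? (0 : \bar R))%E by rewrite mule_def_fin.
    apply: cvgeD.
    + by rewrite mule0.
    + apply: (cvgeM zdef).
        by apply: cvg_EFin => //; exact: nearW.
      exact: dist0.
    + apply: (cvgeM Mdef); last exact: cvg_cst.
      apply: cvg_EFin; first exact: nearW.
      by apply: cvg_norm; apply: cvgB => //; exact: cvg_cst.
have /fine_cvgP[sqrfin sqrcvg] := sqr0.
pose I N := (\int[nu]_u ((sqrte (density mu nu u) -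
    sqrte (density (muN N) nu u)) ^+ 2))%E.
have : (Num.sqrt (2^-1 * fine (I N)))%:E @[N --> \oo] --> (0 : R)%:E.
  apply: cvg_EFin; first exact: nearW.
  rewrite -[X in _ --> X](sqrtr0 R) -[X in Num.sqrt X](mulr0 2^-1).
  by apply: (continuous_cvg _ (@sqrt_continuous R _)); apply: cvgMl_tmp.
apply: cvg_trans; apply: near_eq_cvg; near=> N.
rewrite /hellinger -/(I N) -[in RHS](@fineK _ (I N))//.
by near: N.
Unshelve. all: by end_near.
Qed.
End Hellinger.

Theorem corollary3p7 (R : realType) (a b alpha : R) (psi : R -> R)
    (m : nat) (Sigma : 'M[R]_m)
    (mu0 : probability (sob_borel a b psi alpha) R)
    (C0 : {linear sobolev a b psi alpha -> sobolev a b psi alpha})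
    (e : nat -> sobolev a b psi alpha)
    (y : 'cV[R]_m) (G : sobolev a b psi alpha -> 'cV[R]_m) (lambda : R)
    (muy : probability (sob_borel a b psi alpha) R)
    (muyN : nat -> probability (sob_borel a b psi alpha) R) :
  a < b -> 0 < alpha ->
  Cn a b (frac_order alpha) psi ->
  {in `[a, b] &, {homo psi : x z / x < z}} ->
  {in `[a, b], forall x, deriv_on a b psi x != 0} ->
  spd Sigma ->
  bounded_op C0 -> symmetric_op C0 -> positive_op C0 -> trace_class C0 ->
  centered_gaussian mu0 C0 ->
  onb e ->
  (* (A1) *)
  (forall eps : R, 0 < eps -> exists M : R, forall u,
    norm_wrt Sigma (G u) <= expR (eps * sob_norm u ^+ 2 + M)) ->
  (* (A2) *)
  (forall r : R, 0 < r -> exists2 K : R, 0 < K & forall u1 u2,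
    Num.max (sob_norm u1) (sob_norm u2) < r ->
    norm_wrt Sigma (G u1 - G u2) <= K * sob_norm (u1 - u2)) ->
  0 < lambda ->
  density_propto muy mu0
    (fun u => expR (- potential Sigma G y u - regularizer lambda u)) ->
  (forall N : nat, density_propto (muyN N) mu0
    (fun u => expR (- potential Sigma G y (onb_proj e N u)
                    - regularizer lambda (onb_proj e N u)))) ->
  hellinger mu0 muy (muyN N) @[N --> \oo] --> 0%E.
Proof.
move=> ab _ psiC psi_incr psi'0 _ _ _ _ _ _ eonb _ GL l0 dmu dmuN.
apply: (hellinger_cvg0 dmu dmuN) => [N u|u].
  rewrite expR_ge0 expR_le1 -opprD oppr_le0 addr_ge0//.
    by rewrite mulr_ge0// ?invr_ge0// sqr_ge0.
  by apply: mulr_ge0; [exact: ltW|exact: Rintegral_ge0].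
apply: continuous_cvg; first exact: continuous_expR.
apply: cvgB; first by apply: cvgN; exact: potential_cvg.
by apply: regularizer_cvg => //; exact: ltW.
Qed.
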